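(* Let $G$ be a graph on $n \geq 2$ vertices with maximum degree $\Delta$, and let $t \geq 1$ be an integer. (i) If $0 \leq \Delta \leq 1$, then $f(G) = 0$. (ii) If $\binom{t+1}{2} + 1 \leq \Delta \leq \binom{t+2}{2}$, then $f(G) \leq t$, and this bound is sharp for every $\Delta$ in the range; that is, for every integer $\Delta$ with $\binom{t+1}{2} + 1 \leq \Delta \leq \binom{t+2}{2}$ there exists a graph $G$ with maximum degree $\Delta$ and $f(G) = t$. (iii) If $\Delta \geq 1$, then $f(G) \leq \left\lceil \frac{-3 + \sqrt{8\Delta + 1}}{2} \right\rceil$.
   Context: All graphs are finite and simple. For a graph $G$, $f(G) = f_2(G)$ denotes the minimum number of vertices that must be deleted from $G$ to obtain an induced subgraph $H$ in which at least two vertices have degree $\Delta(H)$ (the maximum degree of $H$), or otherwise $|H| < 2$, where $|H|$ is the number of vertices of $H$. *)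

(* Defs.v *)
From mathcomp Require Import all_boot all_order all_algebra reals.

Set Implicit Arguments.
Unset Strict Implicit.
Unset Printing Implicit Defensive.

Record sgraph := SGraph {
  vertex :> finType;
  adj : rel vertex;
  adj_sym : symmetric adj;
  adj_irrefl : irreflexive adj
}.

Definition degree (G : sgraph) (v : G) : nat := #|[set u : G | adj v u]|.

Definition max_degree (G : sgraph) : nat := \max_(v : G) degree v.

Section Induced.
Variables (G : sgraph) (S : {set G}).

Definition induced_adj : rel {v : G | v \in S} := fun x y => adj (val x) (val y).

Lemma induced_sym : symmetric induced_adj.
Proof. by move=> x y; exact: adj_sym. Qed.

Lemma induced_irrefl : irreflexive induced_adj.
Proof. by move=> x; exact: adj_irrefl. Qed.

Definition induced : sgraph := SGraph induced_sym induced_irrefl.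

End Induced.

Definition two_max_degree (H : sgraph) : bool :=
  (2 <= #|[set v : H | degree v == max_degree H]|) || (#|H| < 2).

Definition del_ok (G : sgraph) (D : {set G}) : bool :=
  two_max_degree (induced (~: D)).

(* Deleting every vertex is always allowed, so the minimum in [f2] is taken
   over a nonempty family. *)
Lemma del_ok_setT (G : sgraph) : del_ok [set: G].
Proof.
apply/orP; right; rewrite ltnS (leq_trans _ (leq0n 1)) // leqn0.
by apply/eqP; rewrite card_sig; apply: eq_card0 => v; rewrite !inE.
Qed.

Definition f2 (G : sgraph) : nat :=
  #|[arg min_(D < [set: G] | del_ok D) #|D| ]|.

Lemma f2_min (G : sgraph) :
  (exists2 D : {set G}, del_ok D & #|D| = f2 G) /\
  (forall D : {set G}, del_ok D -> f2 G <= #|D|).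
Proof.
by rewrite /f2; case: arg_minnP => [|D okD minD]; [exact: del_ok_setT | split=> //; exists D].
Qed.

(* Main.v *)
Require Import Defs.
From mathcomp Require Import all_boot all_order all_algebra reals.
From mathcomp Require Import zify lra.

Set Implicit Arguments.
Unset Strict Implicit.
Unset Printing Implicit Defensive.

(** The upper bound rests on two ways of making progress.  Let [v] have the
    largest degree [d] in a graph and let [w] have the largest degree [e] among
    the other vertices.

    - [v] has at least [d - e] neighbours other than [w] that are not adjacent
      to [w].  Deleting exactly [d - e] of them brings [v] down to degree [e],
      leaves [w] at degree [e], and raises no degree, so [v] and [w] become two
      vertices of maximum degree ([equalize]).
    - Deleting [v] alone leaves a graph of maximum degree at most [e].

    If [d - e <= t], the first way costs at most [t].  Otherwise
    [e <= d - (t + 1)], and as ['C(t.+2, 2) - t.+1 = 'C(t.+1, 2)], the second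
    way turns the bound ['C(t.+2, 2)] on the maximum degree into the same bound
    for [t - 1] at the cost of one vertex.  Induction on [t] gives
    [f2_le_of_max_degree], hence (i) (the case [t = 0]) and the inequality of
    (ii); (iii) follows because the right-hand side is the least
    [c] with [max_degree G <= 'C(c.+2, 2)].

    For sharpness, take [t] disjoint stars whose numbers of leaves are
    ['C(i.+2, 2) + 1] for [i < t.-1], and [Delta] for the last.  Consecutive
    sizes are so far apart that, when fewer than [t] vertices are deleted, the
    largest star whose centre survives cannot be pulled down to the size of the
    next one: the deletions spent on the centres of the larger stars leave too
    few for its leaves.  So that centre remains the only vertex of maximum
    degree ([star_forest_del_ok]). *)

(** * Degrees inside a vertex subset *)

(** Successive deletions would give iterated induced subgraphs, each on its own
    type; measuring degrees relative to a subset of the original vertices keeps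
    everything on one type. *)
Definition deg_in (G : sgraph) (S : {set G}) (v : G) : nat :=
  #|[set u in S | adj v u]|.

Lemma degree_induced (G : sgraph) (S : {set G}) (x : induced S) :
  degree x = deg_in S (val x).
Proof.
rewrite /degree /deg_in -(card_imset _ val_inj).
apply: eq_card => u; rewrite inE; apply/imsetP/andP => [[y]|[uS vu]].
  by rewrite inE => xy ->; split; [exact: valP | exact: xy].
by exists (Sub u uS : induced S); rewrite ?inE //= SubK.
Qed.

Lemma card_induced (G : sgraph) (S : {set G}) : #|induced S| = #|S|.
Proof. by rewrite card_sig; apply: eq_card => v; rewrite !inE. Qed.

Lemma deg_in_le_degree (G : sgraph) (S : {set G}) v : deg_in S v <= degree v.
Proof. by apply: subset_leq_card; apply/subsetP => u; rewrite !inE => /andP[]. Qed.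

Lemma deg_inS (G : sgraph) (S T : {set G}) v :
  S \subset T -> deg_in S v <= deg_in T v.
Proof.
move=> /subsetP sST; apply: subset_leq_card; apply/subsetP => u.
by rewrite !inE => /andP[/sST -> ->].
Qed.

Lemma deg_inD (G : sgraph) (S X : {set G}) v :
  deg_in S v = deg_in (S :\: X) v + #|[set u in S :&: X | adj v u]|.
Proof.
rewrite /deg_in -(cardsID X [set u in S | adj v u]) addnC.
by congr (_ + _); apply: eq_card => u; rewrite !inE;
  case: (u \in X); case: (u \in S); case: (adj v u).
Qed.

Lemma two_max_degree_small (G : sgraph) (S : {set G}) :
  #|S| < 2 -> two_max_degree (induced S).
Proof. by rewrite /two_max_degree card_induced => ->; rewrite orbT. Qed.

Lemma two_max_degree_induced (G : sgraph) (S : {set G}) (v w : G) :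
  v \in S -> w \in S -> v != w -> deg_in S v = deg_in S w ->
  (forall u, u \in S -> deg_in S u <= deg_in S w) ->
  two_max_degree (induced S).
Proof.
move=> vS wS nvw evw maxw; apply/orP; left.
have maxE : max_degree (induced S) = deg_in S w.
  apply/eqP; rewrite eqn_leq; apply/andP; split.
    by apply/bigmax_leqP => x _; rewrite degree_induced; apply: maxw; exact: valP.
  rewrite -[w](SubK (induced S : subType _) wS) -degree_induced.
  exact: (leq_bigmax (F := @degree (induced S))).
pose v' : induced S := exist _ v vS; pose w' : induced S := exist _ w wS.
have nvw' : v' != w' by [].
have <- : #|[set v'; w']| = 2 by rewrite cards2 nvw'.
apply: subset_leq_card; apply/subsetP => x; rewrite !inE.
by move=> /orP[] /eqP->; rewrite degree_induced maxE //= evw.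
Qed.

Lemma not_two_max_degree_induced (G : sgraph) (S : {set G}) (v : G) :
  v \in S -> 0 < deg_in S v ->
  (forall u, u \in S -> u != v -> deg_in S u < deg_in S v) ->
  ~~ two_max_degree (induced S).
Proof.
move=> vS dv_gt0 maxv; rewrite negb_or card_induced -!leqNgt; apply/andP; split.
  pose v' : induced S := exist _ v vS.
  rewrite -(cards1 v'); apply: subset_leq_card; apply/subsetP => x.
  rewrite !inE degree_induced => /eqP dx; apply/eqP/val_inj => /=.
  apply: contraTeq (leqnn (deg_in S v)) => nxv; rewrite -ltnNge.
  apply: leq_trans (maxv _ (valP x) nxv); rewrite ltnS dx.
  rewrite -[v]/(val v') -degree_induced.
  exact: (leq_bigmax (F := @degree (induced S))).
have /card_gt0P[u] := dv_gt0; rewrite inE => /andP[uS vu].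
have nvu : v != u by apply: contraTneq vu => ->; rewrite adj_irrefl.
rewrite -[2]/(true.+1) -nvu -cards2; apply: subset_leq_card.
by apply/subsetP => x; rewrite !inE => /orP[]/eqP->.
Qed.

(** * The upper bound *)

(** Apart from [w] itself, every common neighbour is counted in the degree of
    [w]; if [v] and [w] are adjacent, [w] is lost as a candidate on one side but
    [v] is a neighbour of [w] on the other, so the balance is kept. *)
Lemma private_neighbours (G : sgraph) (S : {set G}) (v w : G) : v \in S ->
  deg_in S v - deg_in S w <= #|[set u in S | adj v u & (u != w) && ~~ adj w u]|.
Proof.
move=> vS; rewrite leq_subLR /deg_in.
set A := [set u in S | adj v u]; set B := [set u in S | adj w u].
set P := [set u in S | _ & _].
(* Replacing [w] by [v] maps the non-private neighbours of [v] into those of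
   [w]. *)
have sub : A \subset P :|: (if adj v w then w |: B :\ v else B).
  apply/subsetP => u; rewrite !inE => /andP[uS vu].
  have nuv : u != v by apply: contraTneq vu => ->; rewrite adj_irrefl.
  case: (eqVneq u w) => [uw|nuw].
    by rewrite -{2}uw vu !inE uw eqxx orbT.
  case: ifP => _; rewrite !inE ?(negPf nuw) uS vu /= ?nuv /=; by case: (adj w u).
apply: leq_trans (subset_leq_card sub) _; apply: leq_trans (leq_card_setU _ _) _.
rewrite addnC leq_add2r; case: ifP => // vw.
have vB : v \in B by rewrite inE vS adj_sym.
by rewrite (cardsD1 v B) vB cardsU1 leq_add2r leq_b1.
Qed.

(** Deleting private neighbours of a vertex of maximum degree costs the
    runner-up nothing, so the gap between the two can be closed exactly. *)
Lemma equalize (G : sgraph) (S : {set G}) (v w : G) :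
  v \in S -> w \in S -> v != w -> deg_in S w <= deg_in S v ->
  (forall u, u \in S -> u != v -> deg_in S u <= deg_in S w) ->
  exists2 D : {set G}, #|D| <= deg_in S v - deg_in S w &
    two_max_degree (induced (S :\: D)).
Proof.
move=> vS wS nvw le_wv maxw.
have [D] : exists2 D : {set G},
    D \subset [set u in S | adj v u & (u != w) && ~~ adj w u] &
    #|D| = deg_in S v - deg_in S w.
  have := private_neighbours w vS; set P := [set u in S | _ & _] => leP.
  have /set0Pn[D] : [set A : {set G} | A \subset P & #|A| == deg_in S v - deg_in S w] != set0.
    by rewrite -card_gt0 cards_draws bin_gt0.
  by rewrite inE => /andP[? /eqP ?]; exists D.
move=> /subsetP sDP cD; exists D; first by rewrite cD.
have inP u : u \in D -> [/\ u \in S, adj v u, u != w & ~~ adj w u].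
  by move=> /sDP; rewrite !inE => /and3P[? ? /andP[]].
have dvE : deg_in (S :\: D) v = deg_in S w.
  have := deg_inD S D v.
  have -> : [set u in S :&: D | adj v u] = D.
    apply/setP => u; rewrite !inE; case: (boolP (u \in D)) => [/inP[-> -> _ _]//|].
    by rewrite andbF.
  by rewrite cD; lia.
have dwE : deg_in (S :\: D) w = deg_in S w.
  have := deg_inD S D w.
  have -> : [set u in S :&: D | adj w u] = set0.
    apply/setP => u; rewrite !inE; case: (boolP (u \in D)) => [/inP[-> _ _ /negPf->]//|].
    by rewrite andbF.
  by rewrite cards0 addn0.
apply: (@two_max_degree_induced _ _ v w) => //.
- by rewrite inE vS andbT; apply/negP => /inP[_]; rewrite adj_irrefl.
- by rewrite inE wS andbT; apply/negP => /inP[_ _]; rewrite eqxx.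
- by rewrite dvE dwE.
move=> u; rewrite inE => /andP[_ uS]; rewrite dwE.
have [->|nuv] := eqVneq u v; first by rewrite dvE.
by apply: leq_trans (deg_inS _ (subsetDl _ _)) (maxw u uS nuv).
Qed.

Lemma two_largest_degrees (G : sgraph) (S : {set G}) : 1 < #|S| ->
  exists v w : G, [/\ v \in S, w \in S, v != w, deg_in S w <= deg_in S v
    & forall u, u \in S -> u != v -> deg_in S u <= deg_in S w].
Proof.
move=> S_big; have /card_gt0P[v0 v0S] : 0 < #|S| by exact: leq_trans S_big.
have [v vS maxv] := arg_maxnP (P := fun u => u \in S) (deg_in S) v0S.
have /card_gt0P[w0 w0S] : 0 < #|S :\ v|.
  by move: S_big; rewrite (cardsD1 v S) vS.
have [w /setD1P[nwv wS] maxw] :=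
  arg_maxnP (P := fun u => u \in S :\ v) (deg_in S) w0S.
exists v, w; split=> //; [by rewrite eq_sym | exact: maxv |].
by move=> u uS nuv; apply: maxw; apply/setD1P.
Qed.

(** Quantifying over all vertex subsets lets the induction go on inside the set
    left by deleting [v].  At [t = 0] there is no second way to progress, and
    none is needed: with all degrees at most one, the two largest agree. *)
Lemma two_max_degree_deletion (G : sgraph) (t : nat) (S : {set G}) :
  (forall u, u \in S -> deg_in S u <= 'C(t.+2, 2)) ->
  exists2 D : {set G}, #|D| <= t & two_max_degree (induced (S :\: D)).
Proof.
elim: t S => [|t IHt] S bound;
  (have [S_small|/two_largest_degrees[v [w [vS wS nvw le_wv maxw]]]] := ltnP #|S| 2;
   first by exists set0; rewrite ?cards0 // setD0; exact: two_max_degree_small);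
  have [D cD okD] := equalize vS wS nvw le_wv maxw.
  exists D => //; apply: leq_trans cD _; rewrite leqn0 subn_eq0.
  (* An edge at [v] makes the degree of its other end, hence of [w], positive. *)
  have [->//|dv_gt0] := posnP (deg_in S v).
  have /card_gt0P[u] := dv_gt0; rewrite inE => /andP[uS vu].
  apply: leq_trans (bound v vS) _; apply: leq_trans (maxw u uS _).
    by apply/card_gt0P; exists v; rewrite inE vS adj_sym.
  by apply: contraTneq vu => ->; rewrite adj_irrefl.
have [small_gap|large_gap] := leqP (deg_in S v - deg_in S w) t.+1.
  by exists D => //; exact: leq_trans small_gap.
have [|D' cD' okD'] := IHt (S :\ v).
  move=> u /setD1P[nuv uS].
  apply: leq_trans (deg_inS _ (subsetDl _ _)) (leq_trans (maxw u uS nuv) _).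
  by have := bound v vS; rewrite binS bin1; lia.
exists (v |: D'); last by rewrite setDDl in okD'.
by rewrite cardsU1; case: (v \notin D') => //; exact: leqW.
Qed.

Lemma f2_le_of_max_degree (G : sgraph) (t : nat) :
  max_degree G <= 'C(t.+2, 2) -> f2 G <= t.
Proof.
move=> leD; have [|D cD okD] := @two_max_degree_deletion G t setT.
  move=> u _; apply: leq_trans (deg_in_le_degree _ _) (leq_trans _ leD).
  exact: leq_bigmax.
apply: leq_trans cD; apply: (f2_min G).2.
by rewrite /del_ok -setTD.
Qed.

(** * Star forests *)

Section StarForest.

Variables (n N : nat) (a : 'I_n -> nat).

(** All stars are cut out of one rectangular grid of vertices; the vertices of
    row [i] beyond column [a i] are isolated, so they do not compete for the
    maximum degree. *)
Definition star_adj : rel ('I_n * 'I_N.+1) := fun x y =>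
  (x.1 == y.1) &&
  [|| (x.2 == ord0) && (0 < y.2 <= a x.1) | (y.2 == ord0) && (0 < x.2 <= a x.1)].

Lemma star_adj_sym : symmetric star_adj.
Proof.
move=> x y; rewrite /star_adj eq_sym.
by case: (eqVneq y.1 x.1) => //= ->; rewrite orbC.
Qed.

Lemma star_adj_irrefl : irreflexive star_adj.
Proof. by move=> [i k]; rewrite /star_adj eqxx orbb /= -val_eqE /=; case: k => [[]]. Qed.

Definition star_forest : sgraph := SGraph star_adj_sym star_adj_irrefl.

Definition centre (i : 'I_n) : star_forest := (i, ord0).

Lemma centre_inj : injective centre.
Proof. by move=> i j []. Qed.

Lemma degree_centre i : a i <= N -> degree (centre i) = a i.
Proof.
move=> le_aN; pose leaf (k : 'I_(a i)) : star_forest := (i, inord k.+1).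
have leafE k : k < a i -> @inord N k.+1 = k.+1 :> nat.
  by move=> ka; rewrite inordK // ltnS (leq_trans ka).
have leaf_inj : injective leaf.
  by move=> k l /(congr1 (fun x : star_forest => x.2 : nat)); rewrite /= !leafE // => -[/val_inj].
rewrite -[RHS]card_ord -(card_codom leaf_inj).
apply: eq_card => -[j k]; rewrite inE /= /star_adj /=.
apply/idP/codomP => [|[l [-> ek]]].
  case/andP=> /eqP <- /orP[/andP[k0 ka]|/andP[_ //]].
  have kP : k.-1 < a i by lia.
  exists (Ordinal kP); congr pair; apply/val_inj; rewrite /= leafE //; lia.
by rewrite eqxx /= ek leafE // ltn_ord.
Qed.

Lemma degree_leaf (x : star_forest) : x.2 != ord0 -> degree x <= 1.
Proof.
move=> x0; rewrite -(cards1 (centre x.1)); apply: subset_leq_card.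
apply/subsetP => -[j k]; rewrite !inE /= /star_adj (negPf x0) /=.
by case/and3P => /eqP <- /eqP -> _.
Qed.

End StarForest.

(** The largest star whose centre survives wins: of the fewer than [n]
    deletions, the centres above [j] use up [n.-1 - j], so at most [j] leaves of
    star [j] are deleted.  The gap condition keeps its centre above the centres
    of smaller stars, and the lower bound on [a] keeps it above every leaf. *)
Lemma star_forest_del_ok (n N : nat) (a : 'I_n -> nat) (D : {set star_forest N a}) :
  (forall i, a i <= N) -> (forall i : 'I_n, i + 2 <= a i) ->
  (forall i j : 'I_n, i < j -> a i + j < a j) ->
  del_ok D -> n <= #|D|.
Proof.
move=> aN a_ge2 a_gap; apply: contraTT; rewrite -ltnNge => ltDn.
have [i0 i0D] : exists i, centre N a i \notin D.
  apply/existsP; apply: contraTT ltDn; rewrite negb_exists -leqNgt => /forallP allD.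
  rewrite -[n in n <= _]card_ord -(card_codom (@centre_inj n N a)).
  by apply: subset_leq_card; apply/subsetP => x /codomP[i ->]; exact/negPn/allD.
have [j jD maxj] := arg_maxnP (P := fun i => centre N a i \notin D) (@nat_of_ord n) i0D.
set c := centre N a j.
pose U := [set x : star_forest N a | (x.2 == ord0) && (j < x.1)].
have cardU : #|U| = n - j.+1.
  have -> : U = [set centre N a i | i in [set i : 'I_n | j < i]].
    apply/setP => -[i k]; rewrite !inE /=; apply/andP/imsetP.
      by case=> /eqP-> ji; exists i; rewrite ?inE.
    by case=> i'; rewrite inE => ji [-> ->].
  rewrite card_imset; last exact: centre_inj.
  have := cardsC [set i : 'I_n | j < i].
  have -> : #|~: [set i : 'I_n | j < i]| = j.+1.
    have jn := ltn_ord j.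
    rewrite -[RHS]card_ord -(card_codom (f := widen_ord jn)); last first.
      by move=> k l /(congr1 (@nat_of_ord _)) /= /val_inj.
    apply: eq_card => i; rewrite !inE -leqNgt; apply/idP/codomP => [ij|[k ->]].
      by exists (Ordinal (ij : i < j.+1)); apply/val_inj.
    by rewrite /= -ltnS.
  by rewrite card_ord; lia.
have lost : #|[set u in setT :&: D | adj c u]| + #|U| <= #|D|.
  have dis : [disjoint [set u in setT :&: D | adj c u] & U].
    rewrite -setI_eq0; apply/eqP/setP => -[i k]; rewrite !inE /= /star_adj /=.
    by apply/negP => /andP[/and3P[_ /eqP <- _]]; rewrite ltnn andbF.
  rewrite -(geq_leqif (leq_card_setU _ _)) in dis.
  apply: leq_trans dis _; apply: subset_leq_card.
  apply/subsetP => -[i k]; rewrite !inE /= => /orP[/andP[//]|/andP[/eqP-> ji]].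
  by apply: contraTT ji => /maxj; rewrite -leqNgt.
have dc : a j - j <= deg_in (~: D) c.
  have := deg_inD setT D c; rewrite setTD.
  have -> : deg_in setT c = a j.
    rewrite -(degree_centre (aN j)); apply: eq_card => u; by rewrite !inE.
  have := ltn_ord j; move: lost; rewrite cardU; lia.
have aj := a_ge2 j.
apply: (@not_two_max_degree_induced _ _ c); rewrite ?inE //; first lia.
move=> [i k] iD nc; apply: leq_ltn_trans (deg_in_le_degree _ _) _.
have [k0|k0] := eqVneq k ord0; last first.
  by apply: leq_ltn_trans (degree_leaf (x := (i, k)) k0) _; lia.
rewrite {}k0 in iD nc *; rewrite degree_centre //.
have nij : i != j by apply: contraNneq nc => ->.
have lij : i < j.
  rewrite ltn_neqAle nij; apply: maxj; by rewrite inE in iD.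
by have := a_gap i j lij; lia.
Qed.

Lemma exists_sharp_graph (t Delta : nat) : 1 <= t ->
  'C(t.+1, 2) + 1 <= Delta <= 'C(t.+2, 2) ->
  exists G : sgraph, max_degree G = Delta /\ f2 G = t.
Proof.
case: t => // t _ /andP[D_ge D_le].
have binE i : 'C(i.+2, 2) = i.+1 + 'C(i.+1, 2) by rewrite binS bin1 addnC.
have bin_mono := fun i j (h : i <= j) => leq_bin2l 2 h.
pose a (i : 'I_t.+1) := if i == t :> nat then Delta else 'C(i.+2, 2) + 1.
have a_le i : a i <= Delta.
  rewrite /a; case: eqP => // nit; have := ltn_ord i.
  by have := bin_mono i.+2 t.+2; lia.
have a_ge (i : 'I_t.+1) : 'C(i.+2, 2) + 1 <= a i.
  by rewrite /a; case: eqP => // ->.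
have a_lt (i : 'I_t.+1) : i < t -> a i = 'C(i.+2, 2) + 1.
  by rewrite /a; case: eqP => //; lia.
have maxE : max_degree (star_forest Delta a) = Delta.
  apply/eqP; rewrite eqn_leq; apply/andP; split.
    apply/bigmax_leqP => -[i k] _; have [->|k0] := eqVneq k ord0.
      by rewrite (degree_centre (a_le i)).
    by apply: leq_trans (degree_leaf (x := (i, k)) k0) _; lia.
  have {1}-> : Delta = degree (centre Delta a ord_max).
    by rewrite degree_centre // /a /= eqxx.
  exact: (leq_bigmax (F := @degree (star_forest Delta a))).
exists (star_forest Delta a); split=> //; apply/eqP; rewrite eqn_leq.
rewrite f2_le_of_max_degree ?maxE //=.
have [[D okD <-] _] := f2_min (star_forest Delta a).
apply: star_forest_del_ok okD => // [i|i j lij].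
  by have := a_ge i; rewrite binE; lia.
rewrite a_lt; last by have := ltn_ord j; lia.
by have := a_ge j; have := bin_mono i.+2 j.+1; rewrite (binE j); lia.
Qed.

(** * The closed form *)

Import Order.TTheory GRing.Theory Num.Theory.

(** [(-3 + sqrt (8 d + 1)) / 2] is the positive root [x] of
    [(x + 1) (x + 2) / 2 = d], and [(c + 1) (c + 2) / 2] is ['C(c.+2, 2)] at a
    natural number [c]. *)
Lemma ceil_root_bin2 (R : realType) (d : nat) : 1 <= d ->
  exists2 c : nat, d <= 'C(c.+2, 2) &
    (c%:Z = Num.ceil ((-3 + Num.sqrt (8 * d%:R + 1)) / 2 : R))%R.
Proof.
move=> d_gt0; set x : R := (_ / 2)%R.
have d1 : (1 <= d%:R :> R)%R by rewrite ler1n.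
have s3 : (3 <= Num.sqrt (8 * d%:R + 1) :> R)%R.
  rewrite -[3%R]ger0_norm // -sqrtr_sqr ler_sqrt; last by lra.
  by rewrite expr2; lra.
have x0 : (0 <= x)%R by rewrite /x; lra.
have c0 : (0 <= Num.ceil x)%R by rewrite -(ceil0 R) le_ceil.
have := ceil_ge x; case: (Num.ceil x) c0 => // c _ le_xc; exists c => //.
have le_sc : (Num.sqrt (8 * d%:R + 1) <= (2 * c + 3)%N%:R :> R)%R.
  by rewrite natrD natrM; move: le_xc; rewrite /x -pmulrn; lra.
have : (8 * d + 1 <= (2 * c + 3) ^ 2)%N.
  rewrite -(ler_nat R) natrX natrD natrM -[leLHS]sqr_sqrtr; last by lra.
  by rewrite lerXn2r ?nnegrE ?sqrtr_ge0.
by have := mul_bin_diag c.+2 1; rewrite /= bin1; lia.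
Qed.

Theorem theorem2p5 (G : sgraph) (hn : 2 <= #|G|) (t : nat) (ht : 1 <= t) :
  [/\ (* (i) *)
      0 <= max_degree G <= 1 -> f2 G = 0,
      (* (ii) *)
      ('C(t.+1, 2) + 1 <= max_degree G <= 'C(t.+2, 2) -> f2 G <= t) /\
      (forall Delta : nat, 'C(t.+1, 2) + 1 <= Delta <= 'C(t.+2, 2) ->
         exists G' : sgraph, max_degree G' = Delta /\ f2 G' = t)
    & (* (iii) *)
      1 <= max_degree G ->
      forall R : realType,
      ((f2 G)%:Z <=
         Num.ceil ((-3 + Num.sqrt (8 * (max_degree G)%:R + 1)) / 2 : R))%R].
Proof.
split.
- by move=> /andP[_ le1]; apply/eqP; rewrite -leqn0; exact: f2_le_of_max_degree.
- split; last by move=> Delta; exact: exists_sharp_graph.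
  by move=> /andP[_]; exact: f2_le_of_max_degree.
- move=> D_gt0 R; have [c le_c <-] := ceil_root_bin2 R D_gt0.
  by rewrite lez_nat; exact: f2_le_of_max_degree.
Qed.
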